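(* Let $\{x_{k\mid k-1}\}_{k\ge0}$ be generated by the FOA-Min or the CP algorithm described in the context (with either choice of $g_k$), with step size $\beta=1/L_1$. Suppose that (1) $f$ is a $\mu$-PL function in terms of $x$; (2) $\|\nabla_{xx}f(x;t)\|\le L_1$ and $\|\nabla_{tx}f(x;t)\|\le L_2$ for all $x\in\mathbb{R}^d$, $t\ge0$; (3) there exists a function $\mathscr{G}:\mathbb{R}\to\mathbb{R}$ such that $f(x;\cdot)-\mathscr{G}(\cdot)$ is twice differentiable for every $x\in\mathbb{R}^d$ and, for all $x\in\mathbb{R}^d$, $t\ge0$: (i) $|\nabla_t[f(x;t)-\mathscr{G}(t)]|\le G_2$; (ii) $|\nabla_{tt}[f(x;t)-\mathscr{G}(t)]|\le L_3$; (iii) $|\nabla_t[f(x;t)-\mathscr{G}(t)]|-Z\|\nabla_x f(x;t)\|\le0$, for some constant $Z\ge0$. Let $\rho:=1-\frac{\mu}{L_1}\in[0,1)$. If the parameters $\zeta,\delta$ satisfy $\zeta\ge Z$ and $\delta\le h$, then for all $k\in\mathbb{N}$, $$f(x_{k\mid k-1};t_k)-f_k^\ast\le\rho^k\bigl(f(x_{0\mid-1};t_0)-f_0^\ast\bigr)+O(h^2),$$ and $$\lim_{k\to\infty}\bigl(f(x_{k\mid k-1};t_k)-f_k^\ast\bigr)=O(h^2).$$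
   Context: $f:\mathbb{R}^d\times\mathbb{R}\to\mathbb{R}$, $(x,t)\mapsto f(x;t)$, is a time-varying objective function; $h>0$ is the sampling period and $t_k:=kh$. $O(\cdot)$ is order notation in the sampling period $h$. For each $t\ge0$, $x^\ast(t)$ denotes an optimal solution of $\min_{x\in\mathbb{R}^d}f(x;t)$; $f_k^\ast:=\min_x f(x;t_k)$. Derivatives: $\nabla_x$ is the gradient in $x$, $\nabla_t$ the derivative in $t$, $\nabla_{ba}f:=\nabla_b(\nabla_a f)$ for $a,b\in\{x,t\}$ (so $\nabla_{xx}$ is the Hessian and $\nabla_{tx}f$ is the $t$-derivative of $\nabla_x f$), assumed to exist. $\|\cdot\|$ is the Euclidean/operator norm. $L_1,L_2,L_3,G_2,\mu$ are constants. PL function: $f$ is a $\mu$-PL (Polyak-Łojasiewicz) function in terms of $x$ if $\frac12\|\nabla_x f(x;t)\|^2\ge\mu(f(x;t)-f(x^\ast(t);t))$ for all $x\in\mathbb{R}^d$ and $t\ge 0$. FOA-Min (First-Order Approximation Minimization) and CP (Cauchy Point) algorithms, with one correction step: given an initial point $x_{0\mid-1}\in\mathbb{R}^d$, step size $\beta$, radius $\zeta>0$ and a sufficiently small threshold $\delta>0$, for $k=0,1,2,\dots$: correction: $x_k=x_{k\mid k-1}-\beta\nabla_x f(x_{k\mid k-1};t_k)$; prediction: set $g_k=\nabla_x f(x_k;t_k)$ or $g_k=2\nabla_x f(x_k;t_k)-\nabla_x f(x_k;t_{k-1})$. If $\|g_k\|\le\delta$, set $x_{k+1\mid k}=x_k$.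 Otherwise set $x_{k+1\mid k}=x_k-s_k\frac{g_k}{\|g_k\|}$, where for FOA-Min $s_k=\zeta h$, and for CP $s_k=\zeta h$ if $g_k^\top\nabla_{xx}f(x_k;t_k)g_k\le0$ and $s_k=\min\left\{\frac{\|g_k\|^3}{g_k^\top\nabla_{xx}f(x_k;t_k)g_k},\zeta h\right\}$ if $g_k^\top\nabla_{xx}f(x_k;t_k)g_k>0$.
   Formalization: The limit in the last claim need not exist (time-periodic f can make the gap oscillate), so it is read as the limit superior as k→∞, whose absolute value is bounded by C h² for all small h. *)

(* Defs.v *)
From HB Require Import structures.
From mathcomp Require Import all_boot all_order all_algebra.
From mathcomp Require Import boolp classical_sets functions reals ereal.
From mathcomp Require Import interval_inference topology normedtype sequences.
From mathcomp Require Import derive.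

Set Implicit Arguments.
Unset Strict Implicit.
Unset Printing Implicit Defensive.

Import Order.TTheory GRing.Theory Num.Theory.
Import numFieldNormedType.Exports.

Local Open Scope classical_set_scope.
Local Open Scope ring_scope.

(* R^d is 'rV[R]_d.  The library norm `|x| on matrices is the sup norm, hence
   the separate Euclidean norm; both induce the same differentiability. *)
Definition enorm (R : realType) (d : nat) (x : 'rV[R]_d) : R :=
  Num.sqrt (\sum_(i < d) x ord0 i ^+ 2).

(* Matrices act on row vectors from the right. *)
Definition opnorm (R : realType) (d : nat) (A : 'M[R]_d) : R :=
  sup [set enorm (v *m A) | v in [set v : 'rV[R]_d | enorm v <= 1]].

Section Objective.
Variables (R : realType) (d : nat).
Implicit Types (f : 'rV[R]_d -> R -> R) (x : 'rV[R]_d) (t : R).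

Definition grad_x f t x : 'rV[R]_d :=
  \row_(i < d) 'D_(delta_mx ord0 i) (fun y => f y t) x.

Definition hess_xx f t x : 'M[R]_d := jacobian (grad_x f t) x.

Definition grad_tx f t x : 'rV[R]_d := derive1 (fun s => grad_x f s x) t.

(* Without these assumptions the total operators above return junk values. *)
Definition derivatives_exist f : Prop :=
  [/\ forall x t, differentiable (fun y => f y t) x,
      forall x t, differentiable (grad_x f t) x
    & forall x t, derivable (fun s => grad_x f s x) t 1].

Definition optimal_trajectory f (xstar : R -> 'rV[R]_d) : Prop :=
  forall t, 0 <= t -> forall x, f (xstar t) t <= f x t.

Definition PL_function f (xstar : R -> 'rV[R]_d) (mu : R) : Prop :=
  forall x t, 0 <= t ->
    2^-1 * enorm (grad_x f t x) ^+ 2 >= mu * (f x t - f (xstar t) t).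

Definition twice_derivable (phi : R -> R) : Prop :=
  (forall t, derivable phi t 1) /\ (forall t, derivable (derive1 phi) t 1).

End Objective.

Inductive method := FOA_Min | Cauchy_Point.

Inductive direction := Current_gradient | Extrapolated_gradient.

Section Algorithm.
Variables (R : realType) (d : nat) (m : method) (c : direction).
Variables (f : 'rV[R]_d -> R -> R) (h beta zeta delta : R).
Implicit Types (x g : 'rV[R]_d) (k : nat).

Definition sample_time k : R := k%:R * h.

Definition correction k x : 'rV[R]_d :=
  x - beta *: grad_x f (sample_time k) x.

(* For k = 0 the previous sampling time t_(k-1) is the negative time - h. *)
Definition search_direction k x : 'rV[R]_d :=
  match c with
  | Current_gradient => grad_x f (sample_time k) x
  | Extrapolated_gradient =>
      2 *: grad_x f (sample_time k) x - grad_x f (sample_time k - h) x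
  end.

Definition step_length k x g : R :=
  match m with
  | FOA_Min => zeta * h
  | Cauchy_Point =>
      let q := (g *m hess_xx f (sample_time k) x *m g^T) ord0 ord0 in
      if q <= 0 then zeta * h else Num.min (enorm g ^+ 3 / q) (zeta * h)
  end.

Definition prediction k x : 'rV[R]_d :=
  let g := search_direction k x in
  if enorm g <= delta then x
  else x - (step_length k x g / enorm g) *: g.

(* predicted x0 k is the iterate x_(k|k-1), started at x_(0|-1) = x0. *)
Fixpoint predicted (x0 : 'rV[R]_d) k : 'rV[R]_d :=
  if k is k'.+1 then prediction k' (correction k' (predicted x0 k')) else x0.

End Algorithm.

(* Main.v *)
Require Import Defs.
From HB Require Import structures.
From mathcomp Require Import all_boot all_order all_algebra.
From mathcomp Require Import boolp classical_sets functions reals ereal.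
From mathcomp Require Import interval_inference topology normedtype sequences.
From mathcomp Require Import derive.
From mathcomp Require Import realfun.
From mathcomp Require Import ring lra.

Set Implicit Arguments.
Unset Strict Implicit.
Unset Printing Implicit Defensive.

Import Order.TTheory GRing.Theory Num.Theory.
Import numFieldNormedType.Exports.

Local Open Scope classical_set_scope.
Local Open Scope ring_scope.

(* With beta = 1/L1, the correction step and the PL inequality contract the gap
   f - f* by rho = 1 - mu/L1.  The prediction step is a normalized gradient step
   of length about zeta h, so it decreases f by zeta h |grad f| + O(h^2); since
   zeta >= Z, this absorbs the first-order drift Z h |grad f| of f - G between
   two sampling times.  The drift of the optimal value is itself O(h^2), because
   the gradient, hence by (iii) the time derivative of f - G, vanishes at a
   minimizer.  So the gap satisfies e_(k+1) <= rho e_k + C0 h^2. *)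

(** * Euclidean geometry of row vectors and derivatives along lines *)

Section Euclid.
Variables (R : realType) (d : nat).
Implicit Types (u v w : 'rV[R]_d) (A : 'M[R]_d).

Definition dotp u v : R := \sum_(i < d) u ord0 i * v ord0 i.

Lemma dotpC u v : dotp u v = dotp v u.
Proof. by apply: eq_bigr => i _; rewrite mulrC. Qed.

Lemma dotpDl u v w : dotp (u + v) w = dotp u w + dotp v w.
Proof. by rewrite -big_split; apply: eq_bigr => i _; rewrite mxE mulrDl. Qed.

Lemma dotpZl a u v : dotp (a *: u) v = a * dotp u v.
Proof. by rewrite mulr_sumr; apply: eq_bigr => i _; rewrite mxE mulrA. Qed.

Lemma dotpNl u v : dotp (- u) v = - dotp u v.
Proof. by rewrite -scaleN1r dotpZl mulN1r. Qed.

Lemma dotpDr u v w : dotp u (v + w) = dotp u v + dotp u w.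
Proof. by rewrite dotpC dotpDl !(dotpC u). Qed.

Lemma dotpZr a u v : dotp u (a *: v) = a * dotp u v.
Proof. by rewrite dotpC dotpZl dotpC. Qed.

Lemma dotpNr u v : dotp u (- v) = - dotp u v.
Proof. by rewrite dotpC dotpNl dotpC. Qed.

Lemma dotpuu_ge0 u : 0 <= dotp u u.
Proof. by apply: sumr_ge0 => i _; rewrite -expr2 sqr_ge0. Qed.

Lemma dotpuu u : dotp u u = enorm u ^+ 2.
Proof.
rewrite sqr_sqrtr; first by apply: eq_bigr => i _; rewrite expr2.
by apply: sumr_ge0 => i _; rewrite sqr_ge0.
Qed.

Lemma enorm_ge0 u : 0 <= enorm u.
Proof. exact: sqrtr_ge0. Qed.

Lemma enormZ a u : enorm (a *: u) = `|a| * enorm u.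
Proof.
apply/eqP; rewrite -(@eqrXn2 _ 2) ?mulr_ge0 ?enorm_ge0//.
by rewrite exprMn real_normK ?num_real// -!dotpuu dotpZl dotpZr mulrA expr2.
Qed.

Lemma enormN u : enorm (- u) = enorm u.
Proof. by rewrite -scaleN1r enormZ normrN1 mul1r. Qed.

Lemma enorm0 : enorm (0 : 'rV[R]_d) = 0.
Proof. by rewrite -(scale0r 0) enormZ normr0 mul0r. Qed.

Lemma coord_le_enorm u i : `|u ord0 i| <= enorm u.
Proof.
rewrite -(@ler_pXn2r _ 2) ?nnegrE ?enorm_ge0// -dotpuu real_normK ?num_real//.
rewrite /dotp (bigD1 i)//= -expr2 lerDl.
by apply: sumr_ge0 => j _; rewrite -expr2 sqr_ge0.
Qed.

Lemma dotp_enorm0l u v : enorm u = 0 -> dotp u v = 0.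
Proof.
move=> u0; apply: big1 => i _.
have -> : u ord0 i = 0; last by rewrite mul0r.
by apply/eqP; rewrite -normr_le0 -u0 coord_le_enorm.
Qed.

Lemma dotp_le u v : dotp u v <= enorm u * enorm v.
Proof.
have [u0|u0] := eqVneq (enorm u) 0; first by rewrite dotp_enorm0l// u0 mul0r.
have [v0|v0] := eqVneq (enorm v) 0.
  by rewrite dotpC dotp_enorm0l// v0 mulr0.
set a := enorm u in u0 *; set b := enorm v in v0 *.
have ab_gt0 : 0 < a * b.
  by rewrite mulr_gt0// lt_def ?u0 ?v0 enorm_ge0.
(* Cauchy-Schwarz: the square of b u - a v expands to 2 a b (a b - [dotp u v]), and the factor a b >
   0 can be cancelled. *)
have := dotpuu_ge0 (b *: u - a *: v).
rewrite !(dotpDl, dotpDr, dotpNl, dotpNr, dotpZl, dotpZr) !dotpuu -/a -/b.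
rewrite (dotpC v u) => H.
rewrite -(ler_pM2l ab_gt0); lra.
Qed.

Lemma enormD u v : enorm (u + v) <= enorm u + enorm v.
Proof.
rewrite -(@ler_pXn2r _ 2) ?nnegrE ?addr_ge0 ?enorm_ge0//.
rewrite -dotpuu !(dotpDl, dotpDr) (dotpC v u) !dotpuu.
have := dotp_le u v; lra.
Qed.

Lemma enormBC u v : enorm (u - v) = enorm (v - u).
Proof. by rewrite -opprB enormN. Qed.

Lemma enorm_le_sum u : enorm u <= \sum_i `|u ord0 i|.
Proof.
rewrite -(@ler_pXn2r _ 2) ?nnegrE ?enorm_ge0// ?sumr_ge0//.
rewrite -dotpuu expr2 mulr_suml; apply: ler_sum => i _.
rewrite -expr2 -real_normK ?num_real// expr2 ler_wpM2l//.
by rewrite (bigD1 i)//= lerDl sumr_ge0.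
Qed.

(** [opnorm] is a [sup], so it dominates the elements of its set only once that set is known to be
    bounded; the sum of all |A i j| is a bound. A general [v] is then scaled to unit length. *)
Lemma enorm_mulmx_le A v : enorm (v *m A) <= opnorm A * enorm v.
Proof.
have ub : has_ubound [set enorm (v *m A) | v in [set v : 'rV[R]_d | enorm v <= 1]].
  exists (\sum_j \sum_i `|A i j|) => _ [w /= w1 <-].
  apply: (le_trans (enorm_le_sum _)); apply: ler_sum => j _.
  rewrite mxE; apply: (le_trans (ler_norm_sum _ _ _)); apply: ler_sum => i _.
  rewrite normrM ler_piMl//; exact: le_trans (coord_le_enorm _ _) w1.
have [v0|v0] := eqVneq (enorm v) 0.
  have -> : v = 0.
    apply/matrixP => i j; rewrite ord1 mxE; apply/eqP.
    by rewrite -normr_le0 -v0 coord_le_enorm.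
  by rewrite mul0mx enorm0 mulr0.
have v_gt0 : 0 < enorm v by rewrite lt_def v0 enorm_ge0.
rewrite -ler_pdivrMr// mulrC.
have -> : (enorm v)^-1 * enorm (v *m A) = enorm (((enorm v)^-1 *: v) *m A).
  by rewrite -scalemxAl enormZ ger0_norm// invr_ge0 ltW.
apply: (ub_le_sup ub); rewrite /=; exists ((enorm v)^-1 *: v) => //=.
by rewrite enormZ ger0_norm ?mulVf ?invr_ge0 ?enorm_ge0.
Qed.

Lemma quad_form_le A v : dotp (v *m A) v <= opnorm A * enorm v ^+ 2.
Proof.
apply: (le_trans (dotp_le _ _)).
by rewrite expr2 mulrA ler_wpM2r ?enorm_ge0 ?enorm_mulmx_le.
Qed.

(** The difference quotients along the line at [s] are exactly those of [F] at [x + s *: v] in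
    direction [v]. *)
Lemma is_derive_line (W : normedModType R) (F : 'rV[R]_d -> W) x v s :
  derivable F (x + s *: v) v ->
  is_derive s (1 : R) (fun s => F (x + s *: v)) ('D_v F (x + s *: v)).
Proof.
have E : (fun h : R => h^-1 *: (F (x + (h *: (1 : R) + s) *: v) - F (x + s *: v)))
   = (fun h => h^-1 *: (F (h *: v + (x + s *: v)) - F (x + s *: v))).
  apply/funext => h; rewrite scalerDl addrCA.
  by rewrite -[(h *: 1)]/(h * 1) mulr1.
move=> dF; split.
  by rewrite /derivable /= E.
by rewrite /derive /= E.
Qed.

Lemma is_derive_dotp (V : normedModType R) (F : V -> 'rV[R]_d) (t e : V) w :
  derivable F t e ->
  is_derive t e (fun s => dotp (F s) w) (dotp ('D_e F t) w).
Proof.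
move=> dF; have dFi := (derivable_mxP _ _ _).1 dF.
rewrite /dotp.
have -> : (fun s => \sum_(i < d) F s ord0 i * w ord0 i) =
          \sum_(i < d) (w ord0 i \*: (fun s => F s ord0 i)).
  by apply/funext => s; rewrite fct_sumE; apply: eq_bigr => i _; rewrite mulrC.
have -> : \sum_(i < d) 'D_e F t ord0 i * w ord0 i =
   \sum_(i < d) w ord0 i *: 'D_e (fun s => F s ord0 i) t.
  by apply: eq_bigr => i _; rewrite derive_mx// mxE mulrC.
by apply: is_derive_sum => i; apply: is_deriveZ; apply/derivableP.
Qed.

(** Differentiability makes the directional derivative linear in [v], so the partial derivatives
    collected in [grad_x] determine it. *)
Lemma dotp_grad (f : 'rV[R]_d -> R -> R) t x v :
  differentiable (f ^~ t) x -> 'D_v (f ^~ t) x = dotp (grad_x f t x) v.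
Proof.
move=> df; rewrite deriveE// {1}(row_sum_delta v) linear_sum.
by apply: eq_bigr => i _; rewrite linearZ mxE deriveE// mulrC.
Qed.

(** Transfers limits taken in the sup-norm topology to Euclidean lengths. *)
Lemma enorm_continuous : continuous (@enorm R d).
Proof.
have sum_cont : continuous (fun u : 'rV[R]_d => \sum_(i < d) u ord0 i ^+ 2).
  apply: continuous_big => [|i _ u]; first exact: add_continuous.
  apply: (@continuous_comp _ _ _ (fun u : 'rV[R]_d => u ord0 i)
    (fun y => y ^+ 2)); first exact: coord_continuous.
  exact: exprn_continuous.
by move=> u; apply: continuous_comp; [exact: sum_cont|exact: sqrt_continuous].
Qed.

End Euclid.

(** * Mean value estimates and limits superior on the real line *)

Section RealFunctions.
Variable R : realType.

Lemma MVT_everywhere (f df : R -> R) a b :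
  a <= b -> (forall x, is_derive x (1 : R) f (df x)) ->
  exists2 c, a <= c <= b & f b - f a = df c * (b - a).
Proof.
move=> ab fdf.
have [c cab fE] := @MVT_segment _ f df a b ab (fun x _ => fdf x)
  (derivable_within_continuous (fun x _ => @ex_derive _ _ _ _ _ _ _ (fdf x))).
by exists c => //; move: cab; rewrite in_itv.
Qed.

Lemma derive1_lipschitz (f : R -> R) a b L :
  (forall s, derivable f s 1) ->
  (forall s, a <= s <= b -> `|derive1 f s| <= L) ->
  forall x y, a <= x <= b -> a <= y <= b -> `|f y - f x| <= L * `|y - x|.
Proof.
move=> df fL x y; wlog xy : x y / x <= y => [H|] xab yab.
  have [/H|/ltW/H] := leP x y; first exact.
  by rewrite distrC (distrC y); exact.
have fdf s : is_derive s (1 : R) f (derive1 f s).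
  by rewrite derive1E; exact/derivableP.
have [c cxy ->] := MVT_everywhere xy fdf.
rewrite normrM ler_wpM2r// fL//; lra.
Qed.

(** The mean value theorem gives the slope f'(c) for some c in [a, a + h], and moving from c to u
    changes f' by at most L h. The point u stays free because the gap estimate needs both ends of
    the interval. *)
Lemma first_order_time_expansion (f : R -> R) a h u L :
  twice_derivable f -> 0 <= h -> a <= u <= a + h ->
  (forall s, a <= s <= a + h -> `|derive1n 2 f s| <= L) ->
  `|f (a + h) - f a - h * derive1 f u| <= L * h ^+ 2.
Proof.
move=> [df ddf] h0 uab fL.
have fdf s : is_derive s (1 : R) f (derive1 f s).
  by rewrite derive1E; exact/derivableP.
have ah : a <= a + h by rewrite lerDl.
have [c cab ->] := MVT_everywhere ah fdf.
have -> : a + h - a = h by ring.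
rewrite mulrC -mulrBr normrM (ger0_norm h0) expr2 mulrA (mulrC L) -mulrA.
rewrite ler_wpM2l//.
apply: (le_trans (derive1_lipschitz ddf fL uab cab)).
have L0 : 0 <= L by apply: le_trans (fL u uab).
by rewrite ler_wpM2l// ler_norml; lra.
Qed.

Lemma limn_esup_le_real (u : R^nat) (l : R) :
  (forall e, 0 < e -> \forall n \near \oo, u n <= l + e) ->
  (limn_esup (fun n => (u n)%:E) <= l%:E)%E.
Proof.
move=> ul; apply/lee_addgt0Pr => e e0; rewrite -EFinD.
(* The limit superior is an infimum of suprema over the sets of the filter, and this set is one of
   them. *)
apply: (@le_trans _ _ (ereal_sup [set (u n)%:E | n in [set n | u n <= l + e]])).
  by apply: ereal_inf_lbound => /=; eexists; [exact: (ul e e0)|].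
by apply: ge_ereal_sup => _ [n /= une <-]; rewrite lee_fin.
Qed.

Lemma limn_esup_ge0_real (u : R^nat) :
  (forall n, 0 <= u n) -> (0 <= limn_esup (fun n => (u n)%:E))%E.
Proof.
move=> u0; apply: limf_esup_ge0 => [|n]; last by rewrite lee_fin.
exact: filter_not_empty.
Qed.

End RealFunctions.

(** * Gradient bounds, the descent lemma and stationarity of minimizers *)

Section SmoothObjective.
Variables (R : realType) (d : nat) (f : 'rV[R]_d -> R -> R).
Implicit Types (x y v w : 'rV[R]_d) (t s L : R).

(** The scalar mean value theorem is applied to the inner product of the gradient with its own
    increment [w]. This gives |w|^2 <= |w| L (t - s), and |w| cancels. *)
Lemma enorm_grad_time_le L x s t :
  (forall u, derivable (fun r => grad_x f r x) u 1) ->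
  (forall u, 0 <= u -> enorm (grad_tx f u x) <= L) ->
  0 <= s <= t -> enorm (grad_x f t x - grad_x f s x) <= L * (t - s).
Proof.
move=> dg gL /andP[s0 st]; set w := (X in enorm X).
have L0 : 0 <= L by apply: le_trans (gL 0 (lexx _)); exact: enorm_ge0.
have [w0|w0] := eqVneq (enorm w) 0; first by rewrite w0 mulr_ge0// subr_ge0.
have [c /andP[sc ct] wE] := MVT_everywhere st (fun u => is_derive_dotp w (dg u)).
have w_gt0 : 0 < enorm w by rewrite lt_def w0 enorm_ge0.
rewrite -(ler_pM2l w_gt0) -expr2 -dotpuu {1}/w dotpDl dotpNl wE.
rewrite mulrA ler_wpM2r ?subr_ge0//.
apply: (le_trans (dotp_le _ _)); rewrite mulrC ler_wpM2l ?enorm_ge0//.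
by rewrite -derive1E; apply: gL; exact: le_trans sc.
Qed.

Variables (L t : R).
Hypothesis df : forall x, differentiable (f ^~ t) x.
Hypothesis dg : forall x, differentiable (grad_x f t) x.
Hypothesis fL : forall x, opnorm (hess_xx f t x) <= L.

(** Along the line, the inner product of the gradient with [v] has the Hessian quadratic form as
    derivative, which is at most L |v|^2. *)
Lemma grad_monotone_bound x v s : 0 <= s ->
  dotp (grad_x f t (x + s *: v) - grad_x f t x) v <= L * enorm v ^+ 2 * s.
Proof.
move=> s0.
have dgl u : is_derive u (1 : R) (fun r => dotp (grad_x f t (x + r *: v)) v)
    (dotp (v *m hess_xx f t (x + u *: v)) v).
  have dl := is_derive_line (diff_derivable (v := v) (dg (x + u *: v))).
  have := is_derive_dotp v (@ex_derive _ _ _ _ _ _ _ dl).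
  by rewrite derive_val deriveEjacobian.
have [c /andP[c0 cs]] := MVT_everywhere s0 dgl.
rewrite scale0r addr0 subr0 dotpDl dotpNl => ->; rewrite ler_wpM2r//.
apply: (le_trans (quad_form_le _ _)); rewrite ler_wpM2r ?sqr_ge0//; exact: fL.
Qed.

(** Quadratic upper bound obtained without integration: [psi] is f on the segment minus the
    nonconstant part of the model. Its derivative is at most 0 for s >= 0 by [grad_monotone_bound],
    hence psi 1 <= psi 0. *)
Lemma descent x v :
  f (x + v) t <= f x t + dotp (grad_x f t x) v + L / 2 * enorm v ^+ 2.
Proof.
pose D := dotp (grad_x f t x) v; pose N := enorm v ^+ 2.
pose psi s := f (x + s *: v) t - s * D - L / 2 * N * s ^+ 2.
have dpsi s : is_derive s (1 : R) psi
    (dotp (grad_x f t (x + s *: v)) v - D - L * N * s).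
  have dl := is_derive_line (diff_derivable (v := v) (df (x + s *: v))).
  rewrite dotp_grad// in dl.
  have -> : psi = (fun r => f (x + r *: v) t) - (D \*: id)
      - (L / 2 * N) \*: (id ^+ 2).
    by apply/funext => r; rewrite /psi !fctE /= (mulrC r).
  apply: is_derive_eq; rewrite !scaler1 /= /GRing.scale/= expr1; lra.
have [c /andP[c0 c1]] := MVT_everywhere ler01 dpsi.
rewrite /psi !scale0r scale1r addr0 subr0 mulr1 expr1n expr0n/= !mulr0 mul0r !mul1r.
have := grad_monotone_bound x v c0; rewrite dotpDl dotpNl -/D -/N.
lra.
Qed.

(** This step minimizes the quadratic bound of [descent]. *)
Lemma gradient_step x : 0 < L ->
  f (x - (1 / L) *: grad_x f t x) t <=
    f x t - (2 * L)^-1 * enorm (grad_x f t x) ^+ 2.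
Proof.
move=> L0; apply: (le_trans (descent _ _)); rewrite enormN enormZ exprMn.
rewrite real_normK ?num_real// dotpNr dotpZr dotpuu -addrA lerD2l.
by rewrite le_eqVlt; apply/orP; left; apply/eqP; field; rewrite gt_eqF.
Qed.

(** A gradient step cannot go below the minimum, yet [gradient_step] forces a decrease proportional
    to the squared gradient norm. *)
Lemma grad_minimizer_eq0 x : 0 < L -> (forall y, f x t <= f y t) ->
  enorm (grad_x f t x) = 0.
Proof.
move=> L0 /(_ (x - (1 / L) *: grad_x f t x)) xmin.
have := le_trans xmin (gradient_step x L0); rewrite lerBrDl gerDr.
rewrite pmulr_rle0 ?invr_gt0 ?mulr_gt0// => ?.
by apply/eqP; rewrite -sqrf_eq0 eq_le sqr_ge0 andbT.
Qed.

End SmoothObjective.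

(** * Effect of one sampling period: prediction step and time drift *)

Section Steps.
Variables (R : realType) (d : nat) (f : 'rV[R]_d -> R -> R).
Implicit Types (x y v w : 'rV[R]_d) (t s L h : R).

(* At k = 0 the extrapolated direction samples the gradient at time - h, where
   the bound L2 is not assumed; only differentiability at 0 controls it. *)
Lemma near_backward_difference (F : R -> 'rV[R]_d) t L :
  derivable F t 1 -> enorm (derive1 F t) <= L ->
  \forall h \near (0 : R)^'+, enorm (F t - F (t - h)) <= (L + 1) * h.
Proof.
rewrite derive1E => dF FL.
have qcvg := cvg_comp _ _ dF (@enorm_continuous R d ('D_1 F t)).
(* The slack 1 makes the bound on the limit strict, so nearby difference quotients satisfy it
   too. *)
have FL1 : enorm ('D_1 F t) < L + 1 by rewrite (le_lt_trans FL)// ltrDl.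
have : nbhs (0 : R) [set h | h != 0 ->
    enorm (h^-1 *: (F (h *: 1 + t) - F t)) < L + 1].
  exact: (cvgr_lt _ qcvg _ FL1).
move=> /nbhs_ballP[e /= e0 eP].
apply/nbhs_ballP; exists e => //= h; rewrite /ball/= sub0r normrN => he h0.
have := eP (- h); rewrite /ball/= sub0r opprK oppr_eq0 gt_eqF// => /(_ he isT).
rewrite /= -[- h *: 1]/(- h * 1) mulr1 enormZ invrN normrN normfV gtr0_norm//.
rewrite enormBC (addrC (- h)) mulrC ltr_pdivrMr//.
exact: ltW.
Qed.

(* The Cauchy step is shorter than zeta h only when |g| <= L zeta h, so the loss
   is of second order. *)
Lemma step_length_bounds m h zeta L k x g :
  0 <= zeta * h -> 0 <= L -> opnorm (hess_xx f (sample_time h k) x) <= L ->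
  let s := step_length m f h zeta k x g in
  0 <= s <= zeta * h /\ (zeta * h - s) * enorm g <= L * (zeta * h) ^+ 2.
Proof.
move=> zh0 L0 hL.
have full : 0 <= zeta * h <= zeta * h /\
    (zeta * h - zeta * h) * enorm g <= L * (zeta * h) ^+ 2.
  by rewrite zh0 lexx subrr mul0r mulr_ge0 ?sqr_ge0.
case: m => /=; rewrite /step_length//.
set q := (g *m _ *m g^T) _ _; case: (lerP q 0) => q0//.
have qL : q <= L * enorm g ^+ 2.
  have -> : q = dotp (g *m hess_xx f (sample_time h k) x) g.
    by rewrite /q mxE; apply: eq_bigr => i _; rewrite [g^T _ _]mxE.
  by apply: (le_trans (quad_form_le _ _)); rewrite ler_wpM2r ?sqr_ge0.
set r := enorm g ^+ 3 / q; rewrite /Num.min; case: ltP => // rzh.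
have g0 := enorm_ge0 g.
have r0 : 0 <= r by rewrite divr_ge0 ?exprn_ge0 ?(ltW q0).
split; first by rewrite r0 ltW.
(* From r q = |g|^3 and q <= L |g|^2, after division by |g|^2. *)
have gr : enorm g <= L * r.
  have [->|gn0] := eqVneq (enorm g) 0; first by rewrite mulr_ge0.
  have g2 : 0 < enorm g ^+ 2 by rewrite exprn_gt0// lt_def gn0.
  have rq : r * q = enorm g ^+ 3 by rewrite divfK ?gt_eqF.
  rewrite -(ler_pM2l g2) -exprSr -rq mulrC (mulrCA _ L) mulrA.
  by rewrite ler_wpM2r.
have : (zeta * h - r) * enorm g <= zeta * h * (L * r).
  by apply: ler_pM; rewrite ?subr_ge0 ?(ltW rzh)// gerBl.
move=> /le_trans; apply; rewrite mulrCA ler_wpM2l// expr2 ler_wpM2l//.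
exact: ltW.
Qed.

(** If |g| <= delta <= h the point stays, and zeta h |p| is itself O(h^2). Otherwise [descent] is
    used at the new time; the errors are the quadratic term, the loss from a shortened Cauchy step,
    and the distances of [g] from the gradients [p] at the old and [P] at the new time, each O(h^2)
    once multiplied by the step length. *)
Lemma prediction_descent m c h zeta delta L1 L2 k x :
  0 <= zeta -> 0 < delta -> delta <= h -> 0 <= L1 -> 0 <= L2 ->
  (forall v, f (x + v) (sample_time h k + h) <=
     f x (sample_time h k + h) + dotp (grad_x f (sample_time h k + h) x) v
     + L1 / 2 * enorm v ^+ 2) ->
  opnorm (hess_xx f (sample_time h k) x) <= L1 ->
  enorm (grad_x f (sample_time h k + h) x - grad_x f (sample_time h k) x)
    <= L2 * h ->
  enorm (search_direction c f h k x - grad_x f (sample_time h k) x)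
    <= (L2 + 1) * h ->
  f (prediction m c f h zeta delta k x) (sample_time h k + h) <=
    f x (sample_time h k + h)
    - zeta * h * enorm (grad_x f (sample_time h k) x)
    + (2 * L1 * zeta ^+ 2 + 3 * zeta * (L2 + 1)) * h ^+ 2.
Proof.
move=> z0 d0 dh L10 L20 desc hL; have h0 := lt_le_trans d0 dh; rewrite /prediction.
set p := grad_x f (sample_time h k) x; set P := grad_x f (_ + h) x.
set g := search_direction c f h k x => Pp gp.
have zh0 : 0 <= zeta * h by rewrite mulr_ge0// ltW.
have pg : enorm p <= enorm g + (L2 + 1) * h.
  have := enormD g (p - g); rewrite addrC subrK enormBC => /le_trans; apply.
  by rewrite lerD2l.
have zpg := ler_wpM2l zh0 pg.
have a1 : 0 <= L1 * zeta ^+ 2 * h ^+ 2 by rewrite mulr_ge0 ?sqr_ge0// mulr_ge0 ?sqr_ge0.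
have a2 : 0 <= zeta * L2 * h ^+ 2 by rewrite mulr_ge0 ?sqr_ge0// mulr_ge0.
have a3 : 0 <= zeta * h ^+ 2 by rewrite mulr_ge0 ?sqr_ge0.
case: (leP (enorm g) delta) => [gd|gd].
  have := ler_wpM2l zh0 (le_trans gd dh); lra.
have [/andP[s0 sz] sg] := step_length_bounds m g zh0 L10 hL.
move: (step_length _ _ _ _ _ _ _) s0 sz sg => s s0 sz sg.
apply: (le_trans (desc _)).
have g0 : enorm g != 0 by rewrite gt_eqF// (lt_trans d0).
rewrite dotpNr dotpZr enormN enormZ exprMn real_normK ?num_real//.
have -> : (s / enorm g) ^+ 2 * enorm g ^+ 2 = s ^+ 2 by rewrite -exprMn divfK.
(* Split g - P as (g - p) + (p - P), of norm at most (L2 + 1) h + L2 h. *)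
have Pg : enorm g ^+ 2 - (2 * L2 + 1) * h * enorm g <= dotp P g.
  have : dotp (g - P) g <= (2 * L2 + 1) * h * enorm g.
    apply: (le_trans (dotp_le _ _)); rewrite ler_wpM2r ?enorm_ge0//.
    have := enormD (g - p) (p - P); rewrite addrA subrK => /le_trans; apply.
    rewrite (enormBC p).
    have -> : (2 * L2 + 1) * h = (L2 + 1) * h + L2 * h by ring.
    exact: lerD.
  rewrite dotpDl dotpNl dotpuu; lra.
have sPg : s * enorm g - s * ((2 * L2 + 1) * h) <= s / enorm g * dotp P g.
  have sg0 : 0 <= s / enorm g by rewrite divr_ge0// enorm_ge0.
  apply: le_trans (ler_wpM2l sg0 Pg).
  by rewrite le_eqVlt; apply/orP; left; apply/eqP; field.
have s2 : s ^+ 2 <= (zeta * h) ^+ 2 by rewrite ler_sqr ?nnegrE.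
have := ler_wpM2l L10 s2.
have h2 : 0 <= (2 * L2 + 1) * h by rewrite mulr_ge0 ?(ltW h0)//; lra.
have := ler_wpM2r h2 sz.
lra.
Qed.

(** The expansion at [x] uses the slope at the left end t, the one at the next minimizer [y] the
    slope at the right end t + h, where it vanishes by the gradient bound. [G] cancels in the
    difference, and f y t is at least the old minimum, so no regularity of [xstar] in time
    enters. *)
Lemma optimality_gap_drift (xstar : R -> 'rV[R]_d) (G : R -> R) t h x Z L3 :
  0 <= h ->
  (forall y, twice_derivable (fun s => f y s - G s)) ->
  (forall y s, t <= s -> `|derive1n 2 (fun r => f y r - G r) s| <= L3) ->
  (forall y s, t <= s ->
    `|derive1 (fun r => f y r - G r) s| <= Z * enorm (grad_x f s y)) ->
  (forall y, f (xstar t) t <= f y t) ->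
  enorm (grad_x f (t + h) (xstar (t + h))) = 0 ->
  f x (t + h) - f (xstar (t + h)) (t + h) <=
    f x t - f (xstar t) t + Z * h * enorm (grad_x f t x) + 2 * L3 * h ^+ 2.
Proof.
move=> h0 dphi phiL phiZ xmin grad0; set y := xstar (t + h) in grad0 *.
have th : t <= t + h by rewrite lerDl.
have expand z u : t <= u <= t + h -> `|f z (t + h) - G (t + h) - (f z t - G t)
    - h * derive1 (fun s => f z s - G s) u| <= L3 * h ^+ 2.
  move=> tu; apply: (first_order_time_expansion (dphi z) h0 tu).
  by move=> s /andP[ts _]; exact: phiL.
have := expand x t; rewrite lexx th => /(_ isT); rewrite ler_norml => /andP[_ Ex].
have := expand y (t + h); rewrite lexx th => /(_ isT).
have -> : derive1 (fun s => f y s - G s) (t + h) = 0.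
  by apply/eqP; rewrite -normr_le0 (le_trans (phiZ _ _ th))// grad0 mulr0.
rewrite mulr0 subr0 ler_norml => /andP[Ey _].
have := xmin y; have := ler_wpM2l h0 (le_trans (ler_norm _) (phiZ x t (lexx t))).
lra.
Qed.

End Steps.


(** * Affine recursions and their asymptotic bound *)

Section Convergence.
Variable R : realType.

(** Writing the constant as (1 - r) D makes D the fixed point of the recursion, so the induction
    closes; D >= 0 serves the base case. *)
Lemma affine_recursion_bound (u : R^nat) (r D : R) :
  0 <= r -> (forall k, u k.+1 <= r * u k + (1 - r) * D) -> 0 <= D ->
  forall k, u k <= r ^+ k * u 0%N + D.
Proof.
move=> r0 uS D0; elim=> [|k IH]; first by rewrite expr0 mul1r lerDl.
apply: (le_trans (uS k)); rewrite exprS.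
have := ler_wpM2l r0 IH; lra.
Qed.

(** The geometric term eventually drops below any e > 0, and u >= 0 removes the absolute value. The
    limit superior is meaningful even if u does not converge. *)
Lemma limn_esup_geometric_bound (u : R^nat) (r D a : R) :
  0 <= r < 1 -> (forall k, 0 <= u k) -> (forall k, u k <= r ^+ k * a + D) ->
  (`| limn_esup (fun k => (u k)%:E) | <= D%:E)%E.
Proof.
move=> /andP[r0 r1] u0 uD; rewrite gee0_abs ?limn_esup_ge0_real//.
apply: limn_esup_le_real => e e0.
have rk : (fun k => a * r ^+ k) @ \oo --> (0 : R).
  by apply: (@cvg_geometric _ a r); rewrite ger0_norm.
apply: filterS (cvgr_lt _ rk _ e0) => k ake.
by apply: (le_trans (uD k)); rewrite addrC lerD2l mulrC ltW.
Qed.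

End Convergence.

(** * The error recursion across sampling times and its conclusion *)

Theorem theorem6 (R : realType) (d : nat) (m : method) (c : direction)
    (L1 L2 L3 G2 mu Z zeta : R)
    (L1_gt0 : 0 < L1) (mu_gt0 : 0 < mu) (Z_ge0 : 0 <= Z) (zeta_gt0 : 0 < zeta)
    (rho_itv : 0 <= 1 - mu / L1 < 1) (zeta_ge : Z <= zeta) :
  exists C : R,
  forall (f : 'rV[R]_d -> R -> R) (xstar : R -> 'rV[R]_d) (x0 : 'rV[R]_d),
    derivatives_exist f ->
    optimal_trajectory f xstar ->
    PL_function f xstar mu ->
    (forall (x : 'rV[R]_d) (t : R), 0 <= t ->
       opnorm (hess_xx f t x) <= L1 /\ enorm (grad_tx f t x) <= L2) ->
    (exists G : R -> R,
       (forall x : 'rV[R]_d, twice_derivable (fun t => f x t - G t)) /\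
       (forall (x : 'rV[R]_d) (t : R), 0 <= t ->
          let phi := fun s => f x s - G s in
          [/\ `|derive1 phi t| <= G2,
              `|derive1n 2 phi t| <= L3
            & `|derive1 phi t| - Z * enorm (grad_x f t x) <= 0])) ->
    \forall h \near (0 : R)^'+, forall delta : R, 0 < delta -> delta <= h ->
      let rho := 1 - mu / L1 in
      let tk := sample_time h in
      let xpred := predicted m c f h (1 / L1) zeta delta x0 in
      let err := fun k : nat => f (xpred k) (tk k) - f (xstar (tk k)) (tk k) in
      (forall k : nat, err k <= rho ^+ k * err 0%N + C * h ^+ 2) /\
      (`| limn_esup (fun k : nat => (err k)%:E) | <= (C * h ^+ 2)%:E)%E.
Proof.
have L1_ge0 := ltW L1_gt0.
have /andP[rho0 rho1] := rho_itv.
(* [C0] adds the constants of [prediction_descent] and [optimality_gap_drift]. The final constant is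
   C0 / (1 - rho), with 1 - rho = mu / L1; it depends on neither f nor the starting point. *)
pose C0 := 2 * L1 * zeta ^+ 2 + 3 * zeta * (L2 + 1) + 2 * L3.
exists (C0 * L1 / mu) => f xstar x0 [df dg dgt] xmin PL bounds [G [dphi phi_bounds]].
have hL x t (t0 : 0 <= t) : opnorm (hess_xx f t x) <= L1 := (bounds x t t0).1.
have gtL x t (t0 : 0 <= t) : enorm (grad_tx f t x) <= L2 := (bounds x t t0).2.
have L2_ge0 : 0 <= L2 := le_trans (enorm_ge0 _) (gtL 0 0 (lexx _)).
have phiL x t : 0 <= t -> `|derive1n 2 (fun s => f x s - G s) t| <= L3.
  by move=> t0; have [] := phi_bounds x t t0.
have phiZ x t : 0 <= t ->
    `|derive1 (fun s => f x s - G s) t| <= Z * enorm (grad_x f t x).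
  by move=> t0; have [_ _] := phi_bounds x t t0; rewrite subr_le0.
have L3_ge0 : 0 <= L3 := le_trans (normr_ge0 _) (phiL 0 0 (lexx _)).
have C0_ge0 : 0 <= C0.
  by rewrite !addr_ge0// !mulr_ge0// ?sqr_ge0// ?(ltW zeta_gt0)// addr_ge0.
(* The first corrected point. Since t_0 = 0 it does not depend on h, so the smallness condition on h
   can be fixed here, before h is introduced. *)
pose y0 := x0 - (1 / L1) *: grad_x f 0 x0.
have near0 := near_backward_difference (dgt y0 0) (gtL y0 0 (lexx _)).
apply: filterS2 (nbhs_right_gt 0) near0 => h h_gt0 back0.
move=> delta delta_gt0 delta_le.
set rho := 1 - mu / L1 in rho_itv rho0 rho1 *; pose tk := sample_time h.
pose xpred := predicted m c f h (1 / L1) zeta delta x0.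
pose err k := f (xpred k) (tk k) - f (xstar (tk k)) (tk k).
have tk_ge0 k : 0 <= tk k by rewrite mulr_ge0// ltW.
have tkS k : tk k.+1 = tk k + h by rewrite /tk /sample_time mulrSr mulrDl mul1r.
pose y k := correction f h (1 / L1) k (xpred k).
have search_close k :
    enorm (search_direction c f h k (y k) - grad_x f (tk k) (y k)) <= (L2 + 1) * h.
  rewrite /search_direction; case: (c).
    by rewrite subrr enorm0 mulr_ge0 ?addr_ge0// ltW.
  (* What remains is the gradient increment between t_k - h and t_k: [back0] bounds it at k = 0, the
     bound on [grad_tx] at later k. *)
  rewrite scaler_nat mulr2n addrAC addrK.
  case: k => [|k].
    have -> : y 0%N = y0 by rewrite /y /correction /sample_time mul0r.
    by rewrite /tk /sample_time mul0r.
  rewrite -/(tk k.+1) tkS addrK.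
  have tt : 0 <= tk k <= tk k + h by rewrite tk_ge0 lerDl ltW.
  have := enorm_grad_time_le (dgt (y k.+1)) (gtL (y k.+1)) tt.
  rewrite (addrC (tk k)) addrK => /le_trans; apply.
  by rewrite ler_pM2r// lerDl.
have err_ge0 k : 0 <= err k by rewrite subr_ge0 xmin.
have errS k : err k.+1 <= rho * err k + C0 * h ^+ 2.
  have t1 : 0 <= tk k + h by rewrite -tkS.
  (* The PL inequality turns the decrease |grad|^2 / (2 L1) into at least (mu / L1) [err k]. *)
  have correct : f (y k) (tk k) - f (xstar (tk k)) (tk k) <= rho * err k.
    have step := gradient_step (df^~ _) (dg^~ _)
      (fun z => hL z _ (tk_ge0 k)) (xpred k) L1_gt0.
    have : L1^-1 * (mu * err k) <=
        L1^-1 * (2^-1 * enorm (grad_x f (tk k) (xpred k)) ^+ 2).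
      by rewrite ler_pM2l ?invr_gt0//; exact: PL.
    rewrite mulrA -invfM (mulrC _ 2) => PLk.
    have -> : rho * err k = err k - L1^-1 * (mu * err k) by rewrite /rho; ring.
    (* Stated for abstract reals with the context cleared, so that [lra] faces only a small linear
       problem. *)
    have combine (a b e q N : R) : a <= b - N -> q <= N -> a - e <= b - e - q.
      by clear; lra.
    exact: combine step PLk.
  have drift := optimality_gap_drift (y k) (ltW h_gt0) dphi
    (fun z s ts => phiL z s (le_trans (tk_ge0 k) ts))
    (fun z s ts => phiZ z s (le_trans (tk_ge0 k) ts)) (xmin _ (tk_ge0 k))
    (grad_minimizer_eq0 (df^~ _) (dg^~ _) (fun z => hL z _ t1) L1_gt0 (xmin _ t1)).
  have tt : 0 <= tk k <= tk k + h by rewrite tk_ge0 lerDl ltW.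
  have gtime : enorm (grad_x f (tk k + h) (y k) - grad_x f (tk k) (y k)) <= L2 * h.
    have := enorm_grad_time_le (dgt (y k)) (gtL (y k)) tt.
    by rewrite (addrC (tk k)) addrK.
  have predict := prediction_descent m (ltW zeta_gt0) delta_gt0 delta_le
    L1_ge0 L2_ge0 (descent (df^~ _) (dg^~ _) (fun z => hL z _ t1) (y k))
    (hL _ _ (tk_ge0 k)) gtime (search_close k).
  have Zzeta : Z * h * enorm (grad_x f (tk k) (y k)) <=
      zeta * h * enorm (grad_x f (tk k) (y k)).
    by rewrite !ler_wpM2r ?enorm_ge0// ltW.
  rewrite {1}/err tkS /xpred [predicted _ _ _ _ _ _ _ _ _]/= -/xpred -/(y k).
  have combine (F1 F2 F3 e E A A' B D : R) : F1 <= F2 - A + B ->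
      F2 - F3 <= e + A' + D -> A' <= A -> e <= E -> F1 - F3 <= E + (B + D).
    by clear; lra.
  rewrite /C0 (mulrDl _ (2 * L3)); exact: combine predict drift Zzeta correct.
have rate : (1 - rho) * (C0 * L1 / mu * h ^+ 2) = C0 * h ^+ 2.
  by rewrite /rho; field; rewrite !gt_eqF.
have errB k : err k <= rho ^+ k * err 0%N + C0 * L1 / mu * h ^+ 2.
  apply: affine_recursion_bound => //; first by move=> j; rewrite rate.
  by rewrite mulr_ge0 ?sqr_ge0// divr_ge0 ?mulr_ge0// ltW.
split=> //.
exact: (limn_esup_geometric_bound rho_itv err_ge0 errB).
Qed.
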